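(* Let $\mathcal M$ be a compact separable metric space with metric $\rho$ and nonnegative Borel measure $\mu$, $\mu(\mathcal M)=1$, which is distance-invariant, i.e. for each $r\in T$ the volume $\mu(B_r(y))$ does not depend on $y\in\mathcal M$. Let $\xi$ be a finite nonnegative measure on $T$. Then for all $y_1,y_2\in\mathcal M$ and $r\in T$, $$2\lambda_r(y_1,y_2)+\rho^*_r(y_1,y_2)=\langle\rho^*_r\rangle,\qquad 2\lambda(\xi,y_1,y_2)+\rho^*(\xi,y_1,y_2)=\langle\rho^*(\xi)\rangle.$$ In particular, for every $N$-point distribution $\mathcal D_N\subset\mathcal M$, $$2\lambda[\xi,\mathcal D_N]+\rho^*[\xi,\mathcal D_N]=N^2\langle\rho^*(\xi)\rangle.$$
   Context: $B_r(y)=\{x:\rho(x,y)\le r\}$; $T=\{\rho(y_1,y_2):y_1,y_2\in\mathcal M\}$. $\chi(E,x)$ is the indicator of $x\in E$. Put $\Lambda(B_r(y),x)=\chi(B_r(y),x)-\mu(B_r(y))$, $\lambda_r(y_1,y_2)=\int_{\mathcal M}\Lambda(B_r(y),y_1)\Lambda(B_r(y),y_2)\,d\mu(y)$, $\lambda(\xi,y_1,y_2)=\int_T\lambda_r(y_1,y_2)\,d\xi(r)$. Put $\rho^*_r(y_1,y_2)=\mu(B_r(y_1)\,\Delta\,B_r(y_2))$, $\rho^*(\xi,y_1,y_2)=\int_T\rho^*_r(y_1,y_2)\,d\xi(r)$, $\langle\rho^*_r\rangle=\iint_{\mathcal M\times\mathcal M}\rho^*_r\,d\mu\,d\mu$,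 $\langle\rho^*(\xi)\rangle=\int_T\langle\rho^*_r\rangle\,d\xi(r)$. For an $N$-point set $\mathcal D_N\subset\mathcal M$: $\lambda[\xi,\mathcal D_N]=\sum_{y_1,y_2\in\mathcal D_N}\lambda(\xi,y_1,y_2)$ and $\rho^*[\xi,\mathcal D_N]=\sum_{y_1,y_2\in\mathcal D_N}\rho^*(\xi,y_1,y_2)$. (Equivalently $\lambda[\xi,\mathcal D_N]=\int_T\int_{\mathcal M}(\#(B_r(y)\cap\mathcal D_N)-N\mu(B_r(y)))^2\,d\mu(y)\,d\xi(r)$.) *)

(* Defs.v *)
From HB Require Import structures.
From mathcomp Require Import all_boot all_order all_algebra finmap.
From mathcomp Require Import all_classical all_reals all_analysis.

Set Implicit Arguments.
Unset Strict Implicit.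
Unset Printing Implicit Defensive.

Import Order.TTheory GRing.Theory Num.Theory.
Import numFieldNormedType.Exports.

Local Open Scope classical_set_scope.
Local Open Scope ring_scope.

(* A measurableType must be pointed, hence a distinguished point is required
   here; this is harmless, as a space carrying a probability is nonempty. *)
#[short(type="pmetricType")]
HB.structure Definition PointedMetric (K : numDomainType) :=
  {M of Metric K M & Pointed M}.

Definition borel (M : ptopologicalType) := g_sigma_algebraType (@open M).

Definition separable (M : topologicalType) : Prop :=
  exists2 S : set M, countable S & dense S.

Section distance_invariance.
Context {R : realType} {M : pmetricType R}.

(* Not the library's closed_ball, which is the closure of the open ball. *)
Definition mball (r : R) (y : M) : set M := [set x | mdist x y <= r].

Definition distances : set R := [set r | exists y1 y2 : M, r = mdist y1 y2].

Variable mu : probability (borel M) R.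

Definition volume (A : set M) : R := fine (mu A).

Definition distance_invariant : Prop :=
  forall r, distances r -> forall y1 y2, mu (mball r y1) = mu (mball r y2).

Definition Lambda (r : R) (y x : M) : R :=
  \1_(mball r y) x - volume (mball r y).

Definition lambda (r : R) (y1 y2 : M) : R :=
  (\int[mu]_(y in [set: borel M]) (Lambda r y y1 * Lambda r y y2))%R.

Definition rhostar (r : R) (y1 y2 : M) : R :=
  volume (mball r y1 `+` mball r y2).

Definition mean_rhostar (r : R) : R :=
  (\int[(mu \x mu)%E]_(z in [set: borel M * borel M]) rhostar r z.1 z.2)%R.

(* A finite Borel measure on the compact set [distances] is represented by a
   finite Borel measure on R, only ever integrated over [distances]. *)
Variable xi : {finite_measure set (measurableTypeR R) -> \bar R}.

Definition lambda_int (y1 y2 : M) : R :=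
  (\int[xi]_(r in distances) lambda r y1 y2)%R.

Definition rhostar_int (y1 y2 : M) : R :=
  (\int[xi]_(r in distances) rhostar r y1 y2)%R.

Definition mean_rhostar_int : R :=
  (\int[xi]_(r in distances) mean_rhostar r)%R.

Definition lambda_sum (D : {fset M}) : R :=
  \sum_(y1 <- D) \sum_(y2 <- D) lambda_int y1 y2.

Definition rhostar_sum (D : {fset M}) : R :=
  \sum_(y1 <- D) \sum_(y2 <- D) rhostar_int y1 y2.

End distance_invariance.

Arguments distances {R} M.

(* Main.v *)
(* By symmetry of the metric, [Lambda r y x] is the centred indicator of the
   ball of radius r about x, evaluated at y.  With v the common volume of the
   balls of radius r and c the volume of the intersection of those about y1 and
   y2, this gives lambda = c - v^2, while rhostar = 2v - 2c.  So 2 lambda +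
   rhostar is the constant 2v - 2v^2, which Fubini identifies with the mean of
   rhostar.  In r, the quantities v, v^2 and c are bounded and nondecreasing,
   hence integrable against any finite measure, so the identity integrates. *)

Require Import Defs.
From HB Require Import structures.
From mathcomp Require Import all_boot all_order all_algebra finmap.
From mathcomp Require Import all_classical all_reals all_analysis.
From mathcomp Require Import ring lra.

Set Implicit Arguments.
Unset Strict Implicit.
Unset Printing Implicit Defensive.

Import Order.TTheory GRing.Theory Num.Theory.
Import numFieldNormedType.Exports.

Local Open Scope classical_set_scope.
Local Open Scope ring_scope.

(** * Indicators and symmetric differences under a probability *)

Section probability_indicators.
Context d (T : measurableType d) (R : realType) (P : probability T R).

Lemma fine_probability_le1 (A : set T) : measurable A -> fine (P A) <= 1.
Proof.
by move=> mA; rewrite -lee_fin fineK ?fin_num_measure// probability_le1.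
Qed.

Lemma fine_probability_mono (A B : set T) : measurable A -> measurable B ->
  A `<=` B -> fine (P A) <= fine (P B).
Proof.
by move=> mA mB AB; rewrite fine_le ?fin_num_measure// le_measure ?inE.
Qed.

Lemma fine_probability_setY (A B : set T) : measurable A -> measurable B ->
  fine (P (A `+` B)) = fine (P A) + fine (P B) - 2 * fine (P (A `&` B)).
Proof.
move=> mA mB.
have mD (C D : set T) : measurable C -> measurable D ->
    fine (P (C `\` D)) = fine (P C) - fine (P (C `&` D)).
  move=> mC mD'; rewrite -fineB ?fin_num_measure//; last exact: measurableI.
  by rewrite measureD// -ge0_fin_numE// fin_num_measure.
rewrite setY_def measureU; do ?exact: measurableD; last first.
  by apply/seteqP; split => // x [[? ?] []].
rewrite fineD ?fin_num_measure //; do ?exact: measurableD.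
by rewrite !mD// [B `&` A]setIC; ring.
Qed.

Lemma Rintegral_indicT (A : set T) : measurable A ->
  \int[P]_(x in setT) \1_A x = fine (P A).
Proof. by move=> mA; rewrite /Rintegral integral_indic// setIT. Qed.

Lemma Rintegral_cstT (k : R) : \int[P]_(x in setT) k = k.
Proof.
rewrite (Rintegral_cst P measurableT) -[RHS]mulr1; congr (_ * _).
exact: (congr1 fine (probability_setT P)).
Qed.

(** This is the covariance of two events. The product expands into indicators of [A], [B] and
    [A]&[B] plus a constant, each of which integrates to a known measure. *)
Lemma Rintegral_centered_indicM (A B : set T) :
    measurable A -> measurable B ->
  \int[P]_(x in setT) ((\1_A x - fine (P A)) * (\1_B x - fine (P B))) =
  fine (P (A `&` B)) - fine (P A) * fine (P B).
Proof.
move=> mA mB; set a := fine (P A); set b := fine (P B).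
have mAB : measurable (A `&` B) by exact: measurableI.
have iI C : measurable C -> P.-integrable setT (EFin \o \1_C : T -> \bar R).
  exact: integrable_indic.
have iZ (k : R) C : measurable C ->
    P.-integrable setT (EFin \o (fun x => k * \1_C x)).
  by move=> mC; exact: (integrableZl measurableT k (iI _ mC)).
have iC (k : R) : P.-integrable setT (EFin \o (fun=> k)).
  exact: finite_measure_integrable_cst.
have iB (f g : T -> R) : P.-integrable setT (EFin \o f) ->
    P.-integrable setT (EFin \o g) ->
    P.-integrable setT (EFin \o (fun x => f x - g x)).
  by move=> If Ig; exact: (integrableB measurableT If Ig).
transitivity (\int[P]_(x in setT)
    (\1_(A `&` B) x - b * \1_A x - (a * \1_B x - a * b))).
  by apply: eq_Rintegral => x _; rewrite indicI /=; ring.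
rewrite !RintegralB//; do ?[exact: iI|exact: iZ|exact: iC|apply: iB => //].
rewrite !RintegralZl//; do ?exact: iI.
rewrite !Rintegral_indicT// Rintegral_cstT -/a -/b.
by ring.
Qed.

End probability_indicators.

(** Monotone functions are Borel, and bounded Borel functions are integrable over a set of finite
    measure. This settles measurability in the radius, since ball volumes grow with [r]. *)
Lemma nondecreasing_bounded_integrable (R : realType)
    (xi : {finite_measure set (measurableTypeR R) -> \bar R})
    (D : set (measurableTypeR R)) (f : R -> R) :
  measurable D -> {homo f : x y / x <= y} -> (forall x, 0 <= f x <= 1) ->
  xi.-integrable D (EFin \o f).
Proof.
move=> mD fnd f01; apply: measurable_bounded_integrable => //.
- by rewrite -ge0_fin_numE// fin_num_measure.
- exact: measurable_realfun.nondecreasing_measurable.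
- exists 1; split => // k k1 x _ /=; have /andP[f0 f1] := f01 x.
  by rewrite ger0_norm// (le_trans f1)// ltW.
Qed.

(** * Continuity of the metric and measurability of the sets built from it *)

Section metric_measurability.
Context {R : realType} {M : pmetricType R}.
Implicit Types (r : R) (x y z : M).

Lemma mdist_dist2 x x' y y' :
  `|mdist x y - mdist x' y'| <= mdist x x' + mdist y y'.
Proof.
have := metric_triangle x x' y; have := metric_triangle x' y' y.
have := metric_triangle x' x y'; have := metric_triangle x y y'.
rewrite (metric_sym x' x) (metric_sym y' y) ler_norml.
by move=> *; apply/andP; split; lra.
Qed.

Lemma continuous_mdist : continuous (fun p : M * M => mdist p.1 p.2 : R).
Proof.
move=> [x y]; apply/cvgrPdist_lt => e e0.
exists (ball x (e / 2), ball y (e / 2)).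
  by split; apply: nbhsx_ballx; rewrite divr_gt0.
move=> [x' y'] [/= ]; rewrite !ballEmdist /= => xx' yy'.
by rewrite (le_lt_trans (mdist_dist2 _ _ _ _))// (splitr e) ltrD.
Qed.

Lemma continuous_mdistr x : continuous (mdist x : M -> R).
Proof.
move=> y; apply: (@continuous_comp _ _ _ (pair x) (fun p => mdist p.1 p.2)).
  by apply: cvg_pair => //; exact: cvg_cst.
exact: continuous_mdist.
Qed.

Lemma open_mdist_lt x r : open [set y | mdist x y < r].
Proof. by apply: open_comp (@open_lt R r) => y _; exact: continuous_mdistr. Qed.

Lemma open_mdist_gt x r : open [set y | r < mdist x y].
Proof. by apply: open_comp (@open_gt R r) => y _; exact: continuous_mdistr. Qed.

Lemma open_measurable_borel (A : set M) :
  open A -> measurable (A : set (borel M)).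
Proof. exact: sub_gen_smallest. Qed.

Lemma measurable_mball r y : measurable (mball r y : set (borel M)).
Proof.
rewrite -[mball r y]setCK; apply: measurableC.
rewrite (_ : ~` _ = [set x | r < mdist y x]).
  by apply: open_measurable_borel; exact: open_mdist_gt.
by apply/seteqP; split => z; rewrite /= /mball /= metric_sym ltNge => /negP.
Qed.

(** The set of distances is the continuous image of the compact square of [M], hence compact, hence
    closed in [R]. *)
Lemma measurable_distances : compact [set: M] ->
  measurable (distances M : set (measurableTypeR R)).
Proof.
move=> cM; apply: measurable_realfun.closed_measurable; apply: compact_closed.
  exact: Rhausdorff.
rewrite (_ : distances M = (fun p : M * M => mdist p.1 p.2) @` setT).
  apply: continuous_compact; last by rewrite -setXTT; exact: compact_setX.
  exact/continuous_subspaceT/continuous_mdist.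
apply/seteqP; split => [t [y1 [y2 ->]]|t [[y1 y2] _ <-]].
  by exists (y1, y2).
by exists y1, y2.
Qed.

(* Separability is what places the closed set [mdist <= r] of the square in
   the product of the Borel sigma-algebras: its complement is a countable union
   of open rectangles centred at the points of a countable dense set. *)
Lemma measurable_mdist_le r : separable M ->
  measurable [set p : borel M * borel M | mdist (p.1 : M) (p.2 : M) <= r].
Proof.
move=> [S cS dS]; rewrite -[X in measurable X]setCK; apply: measurableC.
rewrite (_ : ~` _ = \bigcup_(s : S) \bigcup_(q : rat)
  ([set x : borel M | mdist (\val s) (x : M) < ratr q] `*`
   [set y : borel M | r + ratr q < mdist (\val s) (y : M)])).
  apply: countable_bigcupT_measurable.
    by rewrite (eq_countable (card_setT S)).
  move=> s; apply: bigcupT_measurable_rat => q.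
  apply: measurableX; apply: open_measurable_borel.
    exact: open_mdist_lt.
  exact: open_mdist_gt.
apply/seteqP; split => [[x y] /= /negP|[x y] [s _ [q _] /= [sx sy]]].
  rewrite -ltNge => rxy.
  (* Half the excess over [r] leaves room for two errors: if [z] is within [q] of [x], then
     [mdist z y] exceeds [r + 2 * q - q], that is [r + q]. *)
  have [q q0 qr] : exists2 q : rat,
      0 < ratr q :> R & ratr q < (mdist x y - r) / 2.
    have [|q] := @rat_in_itvoo R 0 ((mdist x y - r) / 2).
      by rewrite divr_gt0// subr_gt0.
    by rewrite in_itv => /andP[]; exists q.
  have [|z [/= xz Sz]] := dS _ _ (open_mdist_lt x (ratr q)).
    by exists x; rewrite /= mdistxx.
  exists (SigSub (mem_set Sz)) => //; exists q => //=.
  split; first by rewrite metric_sym.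
  have := metric_triangle x z y; lra.
apply/negP; rewrite -ltNge.
have := metric_triangle (\val s) x y; lra.
Qed.

End metric_measurability.

(** * The identity at a fixed radius *)

Section invariance_principle.
Context {R : realType} {M : pmetricType R} (mu : probability (borel M) R).
Implicit Types (r : R) (x y z : M).

Lemma rhostarE r y1 y2 : rhostar mu r y1 y2 =
  volume mu (mball r y1) + volume mu (mball r y2) -
  2 * volume mu (mball r y1 `&` mball r y2).
Proof. by apply: fine_probability_setY; exact: measurable_mball. Qed.

Lemma volume_distance_invariant r y z : distance_invariant mu ->
  distances M r -> volume mu (mball r y) = volume mu (mball r z).
Proof. by move=> muinv Tr; rewrite /volume (muinv r Tr y z). Qed.

Lemma lambdaE r y1 y2 : distance_invariant mu -> distances M r ->
  lambda mu r y1 y2 = volume mu (mball r y1 `&` mball r y2) -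
                      volume mu (mball r y1) * volume mu (mball r y2).
Proof.
move=> muinv Tr; rewrite -Rintegral_centered_indicM;
  do ?exact: measurable_mball.
(* [x] lies in the ball about [y] iff [y] lies in the ball about [x], and by
   invariance the two balls have the same volume. *)
apply: eq_Rintegral => y _; rewrite /Lambda.
have LE x : \1_(mball r y) x - volume mu (mball r y) =
            \1_(mball r x) y - volume mu (mball r x) :> R.
  congr (_ - _); last exact: volume_distance_invariant.
  rewrite !indicE; congr (nat_of_bool _)%:R.
  by apply/idP/idP; rewrite !inE /mball /= metric_sym.
by rewrite !LE.
Qed.

Lemma mean_rhostarE r x : separable M -> distance_invariant mu ->
  distances M r ->
  mean_rhostar mu r = 2 * volume mu (mball r x) * (1 - volume mu (mball r x)).
Proof.
move=> Msep muinv Tr; set v := volume mu (mball r x).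
(* Typing the product measure as a probability lets [fine_probability_setY] apply to sets of
   pairs. *)
pose mu2 : probability (borel M * borel M)%type R := (mu \x mu)%E.
have mu2X (B C : set (borel M)) : measurable B -> measurable C ->
    mu2 (B `*` C) = (mu B * mu C)%E.
  exact: product_measure1E.
pose E := [set p : borel M * borel M | mdist (p.1 : M) (p.2 : M) <= r].
have mE : measurable E by exact: measurable_mdist_le.
pose pr1 (p : (borel M * borel M) * borel M) := (p.2, p.1.1).
pose pr2 (p : (borel M * borel M) * borel M) := (p.2, p.1.2).
(* [A] consists of the triples [((y1, y2), y)] with [y] in exactly one of the
   balls about [y1] and [y2]; the mean of [rhostar] is its measure, which is
   computed by integrating over [y] last. *)
pose A := (pr1 @^-1` E) `+` (pr2 @^-1` E).
have mA : measurable A.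
  have mp1 : measurable_fun setT pr1.
    apply: measurable_fun_pair; first exact: measurable_snd.
    exact: measurableT_comp measurable_fst.
  have mp2 : measurable_fun setT pr2.
    apply: measurable_fun_pair; first exact: measurable_snd.
    exact: measurableT_comp measurable_fst.
  have m1 : measurable (pr1 @^-1` E).
    by rewrite -[_ @^-1` _]setTI; exact: mp1.
  have m2 : measurable (pr2 @^-1` E).
    by rewrite -[_ @^-1` _]setTI; exact: mp2.
  by rewrite /A setY_def; apply: measurableU; exact: measurableD.
have xA p : xsection A p = mball r (p.1 : M) `+` mball r (p.2 : M).
  by rewrite xsectionE.
have yA y :
    ysection A y = mball r (y : M) `*` setT `+` setT `*` mball r (y : M).
  rewrite ysectionE; apply/seteqP; split => z;
    rewrite /A /pr1 /pr2 /E /mball /setY /= !(metric_sym _ y); tauto.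
have -> : mean_rhostar mu r =
    \int[mu]_(y in setT) fine (mu2 (ysection A y)).
  rewrite /mean_rhostar /Rintegral; congr fine.
  transitivity (\int[(mu \x mu)%E]_z (mu \o xsection A) z)%E.
    apply: eq_integral => p _; rewrite /rhostar /volume -xA fineK//.
    by rewrite fin_num_measure//; exact: measurable_xsection.
  have := indic_fubini_tonelli mu2 mu mA.
  rewrite indic_fubini_tonelli_FE// indic_fubini_tonelli_GE// => F12.
  apply: etrans F12 _.
  apply: eq_integral => y _ /=.
  by rewrite fineK//; have := fin_num_measure mu2 _ (measurable_ysection y mA).
(* The right-hand side becomes the integral of a constant, so it remains to measure each section of
   [A] separately. *)
rewrite -[RHS](Rintegral_cstT mu); apply: eq_Rintegral => y _.
have mB : measurable (mball r (y : M) : set (borel M)).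
  exact: measurable_mball.
have vE : fine (mu (mball r (y : M))) = v by exact: volume_distance_invariant.
(* The section is the symmetric difference of two strips of measure [v] that meet in a square of
   measure [v ^+ 2]. *)
rewrite yA fine_probability_setY; do ?exact: measurableX.
rewrite -setXI setIT setTI !mu2X//.
rewrite !fineM ?fin_num_measure// !probability_setT vE /=.
by ring.
Qed.

Lemma invariance_principle r y1 y2 : separable M -> distance_invariant mu ->
  distances M r ->
  2 * lambda mu r y1 y2 + rhostar mu r y1 y2 = mean_rhostar mu r.
Proof.
move=> Msep muinv Tr.
rewrite (mean_rhostarE y1)// lambdaE// rhostarE.
by rewrite (volume_distance_invariant y2 y1)//; ring.
Qed.

(** * Integration over the radius and summation over point sets *)

Variable xi : {finite_measure set (measurableTypeR R) -> \bar R}.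

Lemma volume_ge0 (A : set M) : 0 <= volume mu A.
Proof. exact: fine_ge0. Qed.

Lemma mball_subset y : {homo (mball ^~ y) : r s / r <= s >-> r `<=` s}.
Proof. by move=> r s rs x /le_trans; exact. Qed.

Lemma volume_mball_integrable y : compact [set: M] ->
  xi.-integrable (distances M) (EFin \o (fun r => volume mu (mball r y))).
Proof.
move=> Mc; apply: nondecreasing_bounded_integrable.
- exact: measurable_distances.
- move=> r s rs; apply: fine_probability_mono; try exact: measurable_mball.
  exact: mball_subset.
- by move=> r; rewrite volume_ge0 fine_probability_le1//;
    exact: measurable_mball.
Qed.

Lemma volume_mballM_integrable y1 y2 : compact [set: M] ->
  xi.-integrable (distances M)
    (EFin \o (fun r => volume mu (mball r y1) * volume mu (mball r y2))).
Proof.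
move=> Mc; apply: nondecreasing_bounded_integrable.
- exact: measurable_distances.
- move=> r s rs; apply: ler_pM; do ?exact: volume_ge0;
    apply: fine_probability_mono; do ?exact: measurable_mball;
    exact: mball_subset.
- move=> r; rewrite mulr_ge0 ?volume_ge0//= mulr_ile1 ?volume_ge0//;
    apply: fine_probability_le1; exact: measurable_mball.
Qed.

Lemma volume_mballI_integrable y1 y2 : compact [set: M] ->
  xi.-integrable (distances M)
    (EFin \o (fun r => volume mu (mball r y1 `&` mball r y2))).
Proof.
have mI r : measurable (mball r y1 `&` mball r y2 : set (borel M)).
  by apply: measurableI; exact: measurable_mball.
move=> Mc; apply: nondecreasing_bounded_integrable.
- exact: measurable_distances.
- move=> r s rs; apply: fine_probability_mono => //.
  by apply: setISS; exact: mball_subset.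
- by move=> r; rewrite volume_ge0 fine_probability_le1.
Qed.

(** [lambda] need not be monotone in [r], but by [lambdaE] it agrees on [distances M] with a
    difference of two bounded nondecreasing functions. *)
Lemma lambda_integrable y1 y2 : compact [set: M] -> distance_invariant mu ->
  xi.-integrable (distances M) (EFin \o (fun r => lambda mu r y1 y2)).
Proof.
move=> Mc muinv; have mT := measurable_distances Mc.
apply: (eq_integrable mT _ _ _ (integrableB mT
  (volume_mballI_integrable y1 y2 Mc) (volume_mballM_integrable y1 y2 Mc))).
by move=> r /set_mem Tr /=; rewrite lambdaE.
Qed.

Lemma rhostar_integrable y1 y2 : compact [set: M] ->
  xi.-integrable (distances M) (EFin \o (fun r => rhostar mu r y1 y2)).
Proof.
move=> Mc; have mT := measurable_distances Mc.
have iD := integrableD mT (volume_mball_integrable y1 Mc)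
  (volume_mball_integrable y2 Mc).
have iZ := integrableZl mT 2 (volume_mballI_integrable y1 y2 Mc).
apply: (eq_integrable mT _ _ _ (integrableB mT iD iZ)).
by move=> r _ /=; rewrite rhostarE.
Qed.

Lemma invariance_principle_int y1 y2 : compact [set: M] -> separable M ->
  distance_invariant mu ->
  2 * lambda_int mu xi y1 y2 + rhostar_int mu xi y1 y2 = mean_rhostar_int mu xi.
Proof.
move=> Mc Msep muinv; have mT := measurable_distances Mc.
have iL := lambda_integrable y1 y2 Mc muinv.
(* Linearity merges the left-hand side into one integral, whose integrand equals [mean_rhostar] at
   every radius in [distances M]. *)
rewrite -RintegralZl// -RintegralD//; first last.
- exact: rhostar_integrable.
- exact: (integrableZl mT 2 iL).
by apply: eq_Rintegral => r /set_mem Tr; exact: invariance_principle.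
Qed.

End invariance_principle.

Theorem theorem2p1 (R : realType) (M : pmetricType R)
    (mu : probability (borel M) R)
    (xi : {finite_measure set (measurableTypeR R) -> \bar R})
    (Mcompact : compact [set: M]) (Msep : separable M)
    (muinv : distance_invariant mu) :
  (forall (y1 y2 : M) (r : R), distances M r ->
     2 * lambda mu r y1 y2 + rhostar mu r y1 y2 = mean_rhostar mu r) /\
  (forall y1 y2 : M,
     2 * lambda_int mu xi y1 y2 + rhostar_int mu xi y1 y2 =
     mean_rhostar_int mu xi) /\
  (forall (N : nat) (D : {fset M}), #|` D|%fset = N ->
     2 * lambda_sum mu xi D + rhostar_sum mu xi D =
     N%:R ^+ 2 * mean_rhostar_int mu xi).
Proof.
split; first by move=> y1 y2 r; exact: invariance_principle.
have intE y1 y2 := invariance_principle_int xi y1 y2 Mcompact Msep muinv.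
split=> // N D <-; rewrite /lambda_sum /rhostar_sum mulr_sumr -big_split /=.
(* Each ordered pair, diagonal included, contributes the same constant, so both sums only count the
   points of [D]. *)
under eq_bigr => y1 _.
  rewrite mulr_sumr -big_split /=.
  under eq_bigr => y2 _ do rewrite intE.
  rewrite big_const_seq count_predT iter_addr_0.
  over.
rewrite big_const_seq count_predT iter_addr_0 -mulrnA -[LHS]mulr_natl.
by rewrite natrM expr2.
Qed.
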